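(* Let $r,d$ be positive integers. There is a constant $C=C(d,r)>0$ such that for every positive integer $n$ the following holds: if $H$ is an $r$-uniform semialgebraic hypergraph of description complexity $(d,2,1)$ on $N\ge \mathrm{tw}_{12}(Cn)$ vertices, then $H$ contains a clique or an independent set of size $n$.
   Context: The tower function: $\mathrm{tw}_1(x)=x$, $\mathrm{tw}_k(x)=2^{\mathrm{tw}_{k-1}(x)}$. For an ordered set $A$, $A^{(k)}=\{(a_1,\dots,a_k)\in A^k:a_1<\dots<a_k\}$. Semialgebraic hypergraph of description complexity $(d,D,m)$: let $V\subset\mathbb{R}^d$ be a finite totally ordered set, $f_1,\dots,f_m:(\mathbb{R}^d)^r\to\mathbb{R}$ polynomials of total degree at most $D$, and $\Gamma:\{\texttt{false},\texttt{true}\}^m\to\{\texttt{false},\texttt{true}\}$ a Boolean formula; the $r$-uniform hypergraph on $V$ in which $x\in V^{(r)}$ is an edge iff $\Gamma(f_1(x)\le0,\dots,f_m(x)\le0)=\texttt{true}$, and any hypergraph isomorphic to it, is semialgebraic of description complexity $(d,D,m)$. A clique is a vertex set all of whose $r$-subsets are edges; an independent set contains no edge. *)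

(* Defs.v *)
From HB Require Import structures.
From mathcomp Require Import all_boot all_order all_algebra.
From mathcomp Require Import mpoly.
From mathcomp Require Import reals exp.
Set Implicit Arguments. Unset Strict Implicit. Unset Printing Implicit Defensive.
Import Order.TTheory GRing.Theory Num.Theory.
Local Open Scope ring_scope.

Definition tw (R : realType) (k : nat) (x : R) : R :=
  iter k.-1 (fun y => powR 2 y) x.

Section SA.
Variables (R : realType) (d r N : nat).

(* The vertex set V = {p i : i < N} subset of R^d, totally ordered by the index. *)
Definition tuple_mx (p : 'I_N -> 'rV[R]_d) (x : 'I_r -> 'I_N) : 'M[R]_(r, d) :=
  \matrix_(i, j) p (x i) 0 j.

Definition eval_at (p : 'I_N -> 'rV[R]_d) (f : {mpoly R[r * d]})
  (x : 'I_r -> 'I_N) : R :=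
  meval (fun k => mxvec (tuple_mx p x) 0 k) f.

Definition increasing (x : 'I_r -> 'I_N) : Prop :=
  forall i j : 'I_r, (i < j)%N -> (x i < x j)%N.

Definition sa_edge (p : 'I_N -> 'rV[R]_d) (f : {mpoly R[r * d]})
  (Gamma : bool -> bool) (x : 'I_r -> 'I_N) : bool :=
  Gamma (eval_at p f x <= 0).

Definition sa_clique p f Gamma (S : {set 'I_N}) : Prop :=
  forall x, increasing x -> (forall i, x i \in S) -> sa_edge p f Gamma x.

Definition sa_independent p f Gamma (S : {set 'I_N}) : Prop :=
  forall x, increasing x -> (forall i, x i \in S) -> ~~ sa_edge p f Gamma x.

End SA.

(* Main.v *)
Require Import Defs.
From HB Require Import structures.
From mathcomp Require Import all_boot all_order all_algebra.
From mathcomp Require Import mpoly.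
From mathcomp Require Import reals exp.
From mathcomp Require Import zify ring lra.
Set Implicit Arguments. Unset Strict Implicit. Unset Printing Implicit Defensive.
Import Order.TTheory GRing.Theory Num.Theory.

(** A polynomial of degree at most 2 in x_1, ..., x_r is a sum of functions of
    pairs, [sum_{i,j} h_ij(x_i, x_j)], and nothing else about it is used.  After
    Ramsey for 5-tuples the second differences of each h_ij have constant sign
    and are monotone in both coordinates, so along a sparse subsequence they are
    lacunary: consecutive ones differ by a factor K.  Summing them over a suitable
    quadrant gives h_ij(x, y) = u(x) + v(y) + g(x, y) with g lacunary in x and in
    y.  Collecting the one-variable functions and using Ramsey for triples, each
    of them becomes a constant plus a lacunary function.  The polynomial is now a
    sum of O(r^2) terms whose sets of variables are pairwise distinct.  After
    Ramsey for 4-tuples the comparison of two terms does not depend on x; moving a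
    variable that occurs in only one of them changes that term by a factor K, so
    one term dominates all others and decides the sign.  The arities 5, 3, 4 cost
    4 + 2 + 3 exponentials. *)

(** * Ramsey's theorem *)

Lemma pigeonhole_count (T : eqType) (D : finType) (f : T -> D) (V : seq T) m :
  (0 < #|D|)%N -> (#|D| * m <= size V)%N ->
  exists d, (m <= count (fun x => f x == d) V)%N.
Proof.
move=> D0 le; apply/existsP; case: (boolP [exists d, _]) => // /existsPn none.
have cntE : size V = \sum_d count (fun x => f x == d) V.
  elim: V {le none} => [|x V IH] /=; first by rewrite big1.
  rewrite big_split /= -IH (bigD1 (f x)) //= eqxx big1 ?addn0 // => d.
  by rewrite eq_sym => /negPf->.
have [d0 _] : exists d : D, true by move/card_gt0P: D0 => [d _]; exists d.
have: (\sum_(d : D) (count (fun x => f x == d) V).+1 <= \sum_(d : D) m)%N.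
  by apply: leq_sum => d _; rewrite ltnNge none.
rewrite sum_nat_const; under eq_bigr do rewrite -addn1.
rewrite big_split /= -cntE sum_nat_const muln1 => sm.
by have := leq_trans sm le; rewrite -subn_eq0 addKn; move: D0; case: #|D|.
Qed.

(* Arity [k.+1], with [q] colours. *)
Fixpoint ramsey_bound (q k M : nat) : nat :=
  if k is k'.+1 then
    let t := (ramsey_bound q k' M).+1 in ((2 * q ^ (t ^ k)) ^ t)%N
  else (q * M)%N.

Section Ramsey.
Variables (T : eqType) (C : finType).

(* [W] is end-homogeneous over the already chosen prefix [P]: the colour of a
   tuple does not depend on its last element. *)
Fixpoint end_homogeneous k (col : seq T -> C) (P W : seq T) : Prop :=
  if W is w :: W' then
    (forall s x y, size s = k -> {subset s <= P} -> x \in W -> y \in W ->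
       col (rcons s x) = col (rcons s y)) /\
    end_homogeneous k col (rcons P w) W'
  else True.

(** The elements of [s2] pass one by one from [W] into the prefix. Once none is left, only the last
    element varies and the condition at the current head applies. *)
Lemma end_homogeneousP k col P W s1 s2 x y :
  end_homogeneous k col P W -> size (s1 ++ s2) = k -> {subset s1 <= P} ->
  subseq (rcons s2 x) W -> subseq (rcons s2 y) W ->
  col (rcons (s1 ++ s2) x) = col (rcons (s1 ++ s2) y).
Proof.
elim: W P s1 s2 => [|w W IH] P s1 s2; first by case: s2.
move=> [hw hW] sz sub; case: s2 sz => [|a s2] sz.
  rewrite cats0 in sz *; rewrite !sub1seq => xW yW; exact: hw.
rewrite /=; case: eqP => [->|_] sx sy.
  rewrite -!cat_rcons; apply: (IH (rcons P w)) => //.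
    by move: sz; rewrite !size_cat size_rcons /=; lia.
  by move=> z; rewrite !mem_rcons !inE => /orP[->//|/sub->]; rewrite orbT.
apply: (IH (rcons P w)) => // z /sub zP; by rewrite mem_rcons inE zP orbT.
Qed.

(** One pigeonhole per chosen element: the rest of [V] is split by the function that gives, for each
    [k]-tuple over the current prefix, its colour when extended by [x]. With prefix positions
    numbered by ['I_t] there are [Q] such functions; the 2 in [2 * Q] pays for the removal of the
    head [v]. *)
Lemma end_homogeneous_exists k t (col : seq T -> C) n P V :
  (0 < #|C|)%N -> (size P + n <= t)%N ->
  ((2 * #|C| ^ (t ^ k)) ^ n <= size V)%N ->
  (forall s x y, size s = k -> {subset s <= P} -> x \in V -> y \in V ->
       col (rcons s x) = col (rcons s y)) ->
  exists W, [/\ subseq W V, size W = n & end_homogeneous k col P W].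
Proof.
move=> C0; set Q := (#|C| ^ (t ^ k))%N.
have Q0 : (0 < Q)%N by rewrite expn_gt0 C0.
elim: n P V => [|n IH] P V le big hV; first by exists [::]; rewrite sub0seq.
case: V big hV => [|v V] big hV; first by
  move: big; rewrite leqn0 expn_eq0 muln_eq0 /= -leqn0 leqNgt Q0.
pose g x : {ffun k.-tuple 'I_t -> C} :=
  [ffun tau : k.-tuple 'I_t => col (rcons [seq nth v (rcons P v) (i : 'I_t) | i <- tau] x)].
have cD : #|{: {ffun k.-tuple 'I_t -> C}}| = Q.
  by rewrite card_ffun card_tuple card_ord.
have [||d cnt] := @pigeonhole_count _ _ g V ((2 * Q) ^ n)%N.
- by rewrite cD.
- rewrite cD; move: big; rewrite expnS /=.
  have := expn_gt0 (2 * Q)%N n; rewrite muln_gt0 Q0 /= => e0; nia.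
rewrite -size_filter in cnt.
have memd x : x \in [seq x <- V | g x == d] -> (x \in V) /\ g x = d.
  by rewrite mem_filter => /andP[/eqP-> ->].
have [||W [sW szW hW]] := IH (rcons P v) [seq x <- V | g x == d] _ cnt.
- by rewrite size_rcons; lia.
- move=> s x y sz sub /memd[_ gx] /memd[_ gy].
  have ltI z : z \in s -> (index z (rcons P v) < t)%N.
    by move=> /sub; rewrite -index_mem size_rcons => h; lia.
  have [tau tauE] : exists tau : k.-tuple 'I_t,
      [seq nth v (rcons P v) (i : 'I_t) | i <- tau] = s.
    have t0 : (0 < t)%N by lia.
    have szt : size [seq insubd (Ordinal t0) (index z (rcons P v)) | z <- s] == k.
      by rewrite size_map sz.
    exists (Tuple szt); rewrite /= -map_comp -[RHS]map_id; apply/eq_in_map => z zs /=.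
    by rewrite val_insubd ltI // nth_index // sub.
  by have := congr1 (fun f : {ffun _ -> _} => f tau) (etrans gx (esym gy)); rewrite !ffunE tauE.
exists (v :: W); split.
- rewrite /= eqxx; exact: subseq_trans sW (filter_subseq _ _).
- by rewrite /= szW.
split=> // s x y sz sub xW yW; have sub' : {subset v :: W <= v :: V}.
  move=> z; rewrite !inE => /orP[->//|/(mem_subseq sW)/memd[-> _]]; by rewrite orbT.
by apply: hV => //; apply: sub'.
Qed.

(** Induction on the arity. In an end-homogeneous sequence the last element of a tuple may be
    replaced by the final term [z], so [col (rcons s z)] is a colouring of arity one less on the
    terms before [z]. *)
Lemma ramsey_seq k (col : seq T -> C) M (V : seq T) :
  (ramsey_bound #|C| k M <= size V)%N ->
  exists W, [/\ subseq W V, size W = M &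
    exists c, forall s, subseq s W -> size s = k.+1 -> col s = c].
Proof.
have C0 : (0 < #|C|)%N by apply/card_gt0P; exists (col [::]).
elim: k col M V => [|k IH] col M V le.
  have [d cnt] := @pigeonhole_count _ _ (fun x => col [:: x]) V M C0 le.
  rewrite -size_filter in cnt.
  set V' := [seq x <- V | _] in cnt.
  exists (take M V'); split.
  - exact: subseq_trans (take_subseq _ _) (filter_subseq _ _).
  - by rewrite size_take; case: ltngtP cnt.
  exists d => -[|x [|? ?]] // sW _.
  have /mem_take : x \in take M V' by rewrite -sub1seq.
  by rewrite mem_filter => /andP[/eqP].
set t := (ramsey_bound #|C| k M).+1.
have [||||W [sW szW hW]] := @end_homogeneous_exists k.+1 t col t [::] V.
- by [].
- by [].
- exact: le.
- move=> [|? ?] // x y _ sub; by have := sub _ (mem_head _ _).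
case/lastP: W sW szW hW => [|W0 z] // sW szW hW.
have [|W1 [sW1 szW1 [c hc]]] := IH (fun s => col (rcons s z)) M W0.
  by move: szW; rewrite size_rcons => -[->].
have sWz : subseq W0 (rcons W0 z) by apply: subseq_rcons.
exists W1; split=> //; first exact: subseq_trans (subseq_trans sW1 sWz) sW.
exists c => s; case/lastP: s => // s x ss; rewrite size_rcons => -[sz].
have ssx : subseq s W0.
  by apply: subseq_trans (subseq_trans ss sW1); apply: subseq_rcons.
rewrite -(hc s); first last.
- by [].
- by apply: subseq_trans ss; apply: subseq_rcons.
apply: (@end_homogeneousP k.+1 col [::] (rcons W0 z) [::] s) => //.
  exact: subseq_trans (subseq_trans ss sW1) sWz.
by rewrite -!cats1; apply: cat_subseq.
Qed.

End Ramsey.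

Lemma subseq_iota (s : seq nat) n :
  sorted ltn s -> all (fun x => x < n)%N s -> subseq s (iota 0 n).
Proof.
move=> so al; suff -> : s = [seq x <- iota 0 n | x \in s] by apply: filter_subseq.
apply: (irr_sorted_eq ltn_trans ltnn) => //.
  by apply: sorted_filter; [exact: ltn_trans|exact: iota_ltn_sorted].
move=> x; rewrite mem_filter mem_iota /=; case: (boolP (x \in s)) => //= xs.
by rewrite (allP al).
Qed.

Definition increasing_below (a : nat -> nat) (M N : nat) : Prop :=
  (forall i j, (i < j < M)%N -> (a i < a j)%N) /\
  (forall i, (i < M)%N -> (a i < N)%N).

Lemma increasing_below_comp a b M N P :
  increasing_below a M N -> increasing_below b P M ->
  increasing_below (a \o b) P N.
Proof.
move=> [a1 a2] [b1 b2]; split=> [i j /andP[ij jP]|i iP] /=; last exact/a2/b2.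
by apply: a1; rewrite b1 ?ij //= b2.
Qed.

(** The whole family is made homogeneous at once, by colouring a tuple [s] with the function sending
    [j] to [p j s]. Treating the indices in turn would add exponentials for each of them. *)
Lemma ramsey_reindex (J C : finType) k (p : J -> seq nat -> C) M N :
  (ramsey_bound #|{ffun J -> C}| k M <= N)%N ->
  exists a, increasing_below a M N /\
    forall j s t, sorted ltn s -> sorted ltn t -> size s = k.+1 -> size t = k.+1 ->
      all (fun x => x < M)%N s -> all (fun x => x < M)%N t ->
      p j (map a s) = p j (map a t).
Proof.
move=> le; have [|W [sW szW [c hc]]] :=
  @ramsey_seq _ _ k (fun s => [ffun j => p j s]) M (iota 0 N).
  by rewrite size_iota.
have so : sorted ltn W by apply: (subseq_sorted ltn_trans sW); exact: iota_ltn_sorted.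
exists (nth 0 W); split.
  split=> [i j /andP[ij jM]|i iM].
    by apply: (sorted_ltn_nth ltn_trans) => //; rewrite inE szW //; exact: ltn_trans jM.
  have : nth 0 W i \in iota 0 N by apply: (mem_subseq sW); rewrite mem_nth // szW.
  by rewrite mem_iota.
have key s : sorted ltn s -> size s = k.+1 -> all (fun x => x < M)%N s ->
    [ffun j => p j (map (nth 0 W) s)] = c.
  move=> so' sz al; apply: hc; last by rewrite size_map.
  rewrite -[W in subseq _ W](mkseq_nth 0) /mkseq szW; apply: map_subseq.
  exact: subseq_iota.
move=> j s t so1 so2 sz1 sz2 al1 al2.
have := congr1 (fun f : {ffun J -> C} => f j) 
  (etrans (key s so1 sz1 al1) (esym (key t so2 sz2 al2))).
by rewrite !ffunE.
Qed.

(** * Tower bounds *)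

Definition tower (j x : nat) : nat := iter j (expn 2) x.

Lemma leq_towerS j x : (tower j x <= tower j.+1 x)%N.
Proof. by rewrite /= ltnW // ltn_expl. Qed.

Lemma tower_gt0 j x : (0 < x)%N -> (0 < tower j x)%N.
Proof. by case: j => //= j _; rewrite expn_gt0. Qed.

(** As [c * 2 ^ y <= 2 ^ (c * y)] for positive [c] and [y], a constant factor moves through every
    exponential; this is how all constants end up in [C]. *)
Lemma mul_tower j c x : (0 < c)%N -> (0 < x)%N -> (c * tower j x <= tower j (c * x))%N.
Proof.
move=> c0 x0; elim: j => //= j IH.
apply: leq_trans (_ : 2 ^ (c * tower j x) <= _)%N; last by rewrite leq_exp2l.
have t0 := tower_gt0 j x0; move: (tower j x) t0 => y y0.
case: c c0 {IH} => // c _; rewrite [in leqRHS]mulSn expnD mulnC leq_mul //.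
apply: leq_trans (_ : 2 ^ c <= _)%N; first exact: ltn_expl.
by rewrite leq_exp2l // leq_pmulr.
Qed.

Lemma exp_tower j b x : (0 < b)%N -> (0 < x)%N -> (tower j.+1 x ^ b <= tower j.+1 (b * x))%N.
Proof. by move=> b0 x0; rewrite /= -expnM leq_exp2l // mulnC mul_tower. Qed.

Definition tower_bounded (j : nat) (g : nat -> nat) : Prop :=
  exists2 c, (0 < c)%N & forall n, (0 < n)%N -> (g n <= tower j (c * n))%N.

Lemma tower_bounded_affine j g u v :
  tower_bounded j g -> tower_bounded j (fun n => u * g n + v)%N.
Proof.
move=> [c c0 hc]; exists ((u + v).+1 * c)%N; first by rewrite muln_gt0.
move=> n n0; rewrite -mulnA; apply: leq_trans (mul_tower _ _ _); rewrite ?muln_gt0 ?c0 ?n0 //.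
have := hc n n0; have := @tower_gt0 j (c * n); rewrite muln_gt0 c0 n0 => /(_ isT).
move: (tower _ _) (g n) => t x; nia.
Qed.

(** With [y = g n] the quantity is at most [2 ^ (q.+1 * y ^ k.+2)]. Below at least one exponential
    the power of [y] only changes the constant, so one more exponential suffices. *)
Lemma tower_bounded_exp j g q k :
  tower_bounded j.+1 g ->
  tower_bounded j.+2 (fun n => (2 * q ^ (g n ^ k.+1)) ^ g n)%N.
Proof.
move=> [c c0 hc]; exists (q.+1 * (k.+2 * c))%N; first by rewrite !muln_gt0 c0.
move=> n n0; have cn0 : (0 < c * n)%N by rewrite muln_gt0 c0.
have gE := hc n n0; set y := g n in gE *.
have [y0|y0] := posnP y; first by rewrite y0 expn0 tower_gt0 // !muln_gt0 c0 n0.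
have y_bound : (y ^ k.+2 <= tower j.+1 (k.+2 * (c * n)))%N.
  by apply: leq_trans (exp_tower _ _ _) => //; rewrite leq_exp2r.
apply: leq_trans (_ : 2 ^ (q.+1 * y ^ k.+2) <= _)%N.
  have -> : (q.+1 * y ^ k.+2 = q.+1 * y ^ k.+1 * y)%N by rewrite -mulnA -expnSr.
  rewrite expnM leq_exp2r // [in leqRHS]mulSn expnD.
  apply: leq_mul; first by rewrite -{1}(expn1 2) leq_exp2l // expn_gt0 y0.
  by rewrite expnM leq_exp2r ?expn_gt0 ?y0 // ltnW // ltn_expl.
rewrite [tower j.+2 _]/= leq_exp2l // -!mulnA.
apply: leq_trans (mul_tower j.+1 _ _) => //; last by rewrite muln_gt0 cn0.
by rewrite leq_mul2l y_bound orbT.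
Qed.

Lemma tower_bounded_ramsey j g q k :
  tower_bounded j.+1 g -> tower_bounded (j.+1 + k) (fun n => ramsey_bound q k (g n)).
Proof.
move=> hg; elim: k => [|k IH].
  rewrite addn0; have [c c0 hc] := tower_bounded_affine q 0 hg.
  by exists c => // n /hc; rewrite addn0.
rewrite addnS; apply: (@tower_bounded_exp _ (fun n => (ramsey_bound q k (g n)).+1)).
have [c c0 hc] := tower_bounded_affine 1 1 IH.
by exists c => // n /hc; rewrite mul1n addn1.
Qed.

Local Open Scope ring_scope.

Lemma tw_nat (R : realType) k m : tw k.+1 (m%:R : R) = (tower k m)%:R.
Proof.
rewrite /tw /=; elim: k => //= k ->.
by rewrite powR_mulrn // GRing.natrX.
Qed.

(** * Lacunary functions *)

Section Lacunarity.
Variable R : realFieldType.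
Implicit Types (f g : nat -> R) (h : nat -> nat -> R).

Definition lac_step (up : bool) (K : nat) (u v : R) : Prop :=
  if up then K%:R * `|u| <= `|v| else K%:R * `|v| <= `|u|.

Definition lacunary K M f : Prop :=
  exists up, forall x x', (x < x')%N -> (x' < M)%N -> lac_step up K (f x) (f x').

Definition lacunary_left K M h : Prop :=
  exists up, forall x x' y, (x < x')%N -> (x' < y)%N -> (y < M)%N ->
    lac_step up K (h x y) (h x' y).

Definition lacunary_right K M h : Prop :=
  exists up, forall x y y', (x < y)%N -> (y < y')%N -> (y' < M)%N ->
    lac_step up K (h x y) (h x y').

Lemma lac_step_chain up K f a b : (0 < K)%N -> (a < b)%N ->
  (forall z, (a <= z < b)%N -> lac_step up K (f z) (f z.+1)) ->
  lac_step up K (f a) (f b).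
Proof.
move=> K0; elim: b => // b IH; rewrite ltnS leq_eqVlt => /orP[/eqP <-|ab] st.
  by apply: st; rewrite leqnn /=.
have K1 : 1 <= K%:R :> R by rewrite ler1n.
have := st b; rewrite (ltnW ab) /= ltnS leqnn => /(_ isT).
have := IH ab (fun z zb => st z ltac:(lia)).
rewrite /lac_step; have := normr_ge0 (f b); have := normr_ge0 (f b.+1).
by case: up {st IH} => ? ? ? ?; nra.
Qed.

(** The gaps [b - a] and [c - b] are arbitrary, so this is much stronger than convexity or
    concavity: a long increment is compared even with a single adjacent step. *)
Definition increments_monotone (up : bool) lo hi f : Prop :=
  forall a b c, (lo <= a)%N -> (a < b)%N -> (b < c)%N -> (c <= hi)%N ->
    if up then f b - f a <= f c - f b else f c - f b <= f b - f a.

(** Every unit step beyond [b] is compared with the increment from [a] to its starting point, which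
    contains the one from [a] to [b]; [s] steps gain [s] times as much. *)
Lemma increments_up lo hi f s a b :
  (forall x y, (lo <= x)%N -> (x <= y)%N -> (y <= hi)%N -> f x <= f y) ->
  increments_monotone true lo hi f ->
  (lo <= a)%N -> (a < b)%N -> (b + s <= hi)%N ->
  s%:R * (f b - f a) <= f (b + s)%N - f b.
Proof.
move=> mono inc la ab; elim: s => [|s IH] bs; first by rewrite addn0; lra.
have {}IH := IH ltac:(lia).
have i1 := inc a (b + s)%N (b + s.+1)%N la ltac:(lia) ltac:(lia) bs.
have m1 := mono b (b + s)%N ltac:(lia) ltac:(lia) ltac:(lia).
by rewrite -natr1 mulrDl mul1r; lra.
Qed.

Lemma increments_down lo hi f s b c :
  (forall x y, (lo <= x)%N -> (x <= y)%N -> (y <= hi)%N -> f x <= f y) ->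
  increments_monotone false lo hi f ->
  (lo + s <= b)%N -> (b < c)%N -> (c <= hi)%N ->
  s%:R * (f c - f b) <= f b - f (b - s)%N.
Proof.
move=> mono dec + bc ch; elim: s => [|s IH] bs; first by rewrite subn0; lra.
have {}IH := IH ltac:(lia).
have i1 := dec (b - s.+1)%N (b - s)%N c ltac:(lia) ltac:(lia) ltac:(lia) ch.
have m1 := mono (b - s)%N b ltac:(lia) ltac:(lia) ltac:(lia).
by rewrite -natr1 mulrDl mul1r; lra.
Qed.

(** The constant is the value of [f] at the end where its increments are smallest. What remains is
    an increment measured from that end, and the [L] unit steps between sample points supply the
    factor [L]. *)
Lemma lacunary_unary L M f up :
  (0 < L)%N ->
  (forall x y, (x <= y)%N -> (y <= L * M)%N -> f x <= f y) ->
  increments_monotone up 0 (L * M) f ->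
  exists c, lacunary L M (fun x => f (L * x)%N - c).
Proof.
move=> L0 mono incs.
have mono' x y : (0 <= x)%N -> (x <= y)%N -> (y <= L * M)%N -> f x <= f y.
  by move=> _; exact: mono.
exists (if up then f 0%N else f (L * M)%N); exists up => x x' xx' x'M.
have LxM : (L * x' <= L * M)%N by rewrite leq_mul2l (ltnW x'M) orbT.
have Lxx : (L * x + L <= L * x')%N by rewrite -mulnSr leq_mul2l xx' orbT.
have LxM' : (L * x' + L <= L * M)%N by rewrite -mulnSr leq_mul2l x'M orbT.
rewrite /lac_step; case: up incs => incs.
  rewrite !ger0_norm ?subr_ge0 ?mono //; last by lia.
  have [->|x0] := posnP x; first by rewrite muln0 subrr mulr0 subr_ge0 mono.
  have Lx0 : (0 < L * x)%N by rewrite muln_gt0 L0.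
  have := @increments_up 0 (L * M) f L 0 (L * x) mono' incs (leqnn _) Lx0 ltac:(lia).
  have := mono (L * x + L)%N (L * x')%N Lxx LxM.
  have := mono 0%N (L * x)%N (leq0n _) ltac:(lia); lra.
rewrite !ler0_norm ?subr_le0 ?mono //; last by lia.
have := @increments_down 0 (L * M) f L (L * x') (L * M) mono' incs ltac:(lia) ltac:(lia) (leqnn _).
have := mono (L * x)%N (L * x' - L)%N ltac:(lia) ltac:(lia).
have := mono (L * x')%N (L * M)%N ltac:(lia) ltac:(lia); lra.
Qed.

(** The mixed second difference over the rectangle [a, b] x [c, d]: it is additive under cutting the
    rectangle and vanishes on functions of one variable. *)
Definition rect h a b c d : R := h b d - h a d - h b c + h a c.

(** * Second differences on a sparse grid *)

Section Cells.
Variables (h : nat -> nat -> R) (L M : nat) (xup yup : bool).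
Hypothesis L0 : (0 < L)%N.
Hypothesis rect_ge0 : forall a b c d,
  (a < b)%N -> (b < c)%N -> (c < d)%N -> (d <= M)%N -> 0 <= rect h a b c d.
Hypothesis rect_left : forall a b c d e,
  (a < b)%N -> (b < c)%N -> (c < d)%N -> (d < e)%N -> (e <= M)%N ->
  if xup then rect h a b d e <= rect h b c d e
  else rect h b c d e <= rect h a b d e.
Hypothesis rect_right : forall a b c d e,
  (a < b)%N -> (b < c)%N -> (c < d)%N -> (d < e)%N -> (e <= M)%N ->
  if yup then rect h a b c d <= rect h a b d e
  else rect h a b d e <= rect h a b c d.

Let h' x y := h (L * x)%N (L * y)%N.
Definition cell k l : R := rect h' k k.+1 l l.+1.

Let mulS k : (L * k.+1 = L * k + L)%N. Proof. by rewrite mulnSr. Qed.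

Lemma cell_ge0 k l : (k.+2 <= l)%N -> (L * l.+1 <= M)%N -> 0 <= cell k l.
Proof.
move=> kl lM; apply: rect_ge0 => //; rewrite ?ltn_pmul2l //; lia.
Qed.

(** For fixed [c] and [d] the function [f] has one variable: nonnegative rectangles make it
    nondecreasing, and [rect_left] orders its increments. The gap between [k] and [l] keeps both
    cells strictly off the diagonal. *)
Lemma cell_left k l : (k.+3 <= l)%N -> (L * l.+1 <= M)%N ->
  lac_step xup L (cell k l) (cell k.+1 l).
Proof.
move=> kl lM; rewrite /lac_step !ger0_norm ?cell_ge0 //; last by lia.
set c := (L * l)%N; set d := (L * l.+1)%N.
have cd : (c < d)%N by rewrite ltn_pmul2l.
have kc : (L * k.+2 < c)%N by rewrite ltn_pmul2l.
pose f t := h t d - h t c.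
have mono x y : (0 <= x)%N -> (x <= y)%N -> (y <= L * k.+2)%N -> f x <= f y.
  move=> _; rewrite leq_eqVlt => /orP[/eqP->//|xy] yk.
  by have := @rect_ge0 x y c d xy ltac:(lia) cd lM; rewrite /rect /f; lra.
have incs : increments_monotone xup 0 (L * k.+2) f.
  move=> a b e _ ab be ek; have := @rect_left a b e c d ab be ltac:(lia) cd lM.
  by rewrite /rect /f; case: (xup) => ?; lra.
have -> : cell k l = f (L * k.+1)%N - f (L * k)%N by rewrite /cell /rect /h' /f; ring.
have -> : cell k.+1 l = f (L * k.+2)%N - f (L * k.+1)%N by rewrite /cell /rect /h' /f; ring.
case: xup incs => incs.
  by rewrite [in leRHS]mulS; apply: (increments_up mono incs); lia.
have -> : (L * k = L * k.+1 - L)%N by lia.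
by apply: (increments_down mono incs); lia.
Qed.

Lemma cell_right k l : (k.+2 <= l)%N -> (L * l.+2 <= M)%N ->
  lac_step yup L (cell k l) (cell k l.+1).
Proof.
move=> kl lM; have lM' : (L * l.+1 <= M)%N by lia.
rewrite /lac_step !ger0_norm ?cell_ge0 //; last by lia.
set a := (L * k)%N; set b := (L * k.+1)%N.
have ab : (a < b)%N by rewrite ltn_pmul2l.
have bl : (b < L * l)%N by rewrite ltn_pmul2l.
pose f t := h b t - h a t.
have mono x y : (L * l <= x)%N -> (x <= y)%N -> (y <= M)%N -> f x <= f y.
  move=> lx; rewrite leq_eqVlt => /orP[/eqP->//|xy] yM.
  by have := @rect_ge0 a b x y ab ltac:(lia) xy yM; rewrite /rect /f; lra.
have incs : increments_monotone yup (L * l) M f.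
  move=> x y z lx xy yz zM; have := @rect_right a b x y z ab ltac:(lia) xy yz zM.
  by rewrite /rect /f; case: (yup) => ?; lra.
have -> : cell k l = f (L * l.+1)%N - f (L * l)%N by rewrite /cell /rect /h' /f; ring.
have -> : cell k l.+1 = f (L * l.+2)%N - f (L * l.+1)%N by rewrite /cell /rect /h' /f; ring.
case: yup incs => incs.
  by rewrite [in leRHS]mulS; apply: (increments_up mono incs); lia.
have -> : (L * l = L * l.+1 - L)%N by lia.
by apply: (increments_down mono incs); lia.
Qed.

End Cells.

(** * Sums over half-lines and quadrants *)

Definition half_line (up : bool) M x : seq nat :=
  if up then index_iota 0 x else index_iota x M.

(** Shifting the index by one matches each summand of the smaller sum with a summand of the other
    that is at least [K] times as large; the unmatched summand is nonnegative. *)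
Lemma half_line_step up M K x f :
  (forall k, 0 <= f k) -> (x < M)%N ->
  (forall k, k \in half_line up M x -> (k.+1 < M)%N ->
     if up then K%:R * f k <= f k.+1 else K%:R * f k.+1 <= f k) ->
  lac_step up K (\sum_(k <- half_line up M x) f k)
                (\sum_(k <- half_line up M x.+1) f k).
Proof.
move=> f0 xM st; have s0 r : 0 <= \sum_(k <- r) f k by apply: sumr_ge0.
rewrite /lac_step !ger0_norm //; case: up st => st; rewrite /half_line mulr_sumr.
  rewrite -/(index_iota _ _) big_nat_recl // -[leLHS]add0r lerD //.
  rewrite !big_nat; apply: ler_sum => k kx; apply: st; last by lia.
  by rewrite mem_index_iota.
case: M xM st => // M; rewrite ltnS => xM st.
rewrite big_add1 /= (@big_nat_recr _ _ _ M) //= -[leLHS]addr0 lerD //.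
rewrite !big_nat; apply: ler_sum => k kx; apply: st; last by lia.
by rewrite mem_index_iota; lia.
Qed.

(** The index [i0] has no partner of its own and borrows [g j0], which may then be counted twice.
    The factor [2 * K] in the hypotheses, against [K] in the conclusion, pays for this. *)
Lemma ler_sum_exception (r : seq nat) K f g i0 j0 :
  uniq r -> j0 \in r -> (forall k, 0 <= g k) ->
  (forall k, k \in r -> k != i0 -> (2 * K)%:R * f k <= g k) ->
  (2 * K)%:R * f i0 <= g j0 ->
  K%:R * (\sum_(k <- r) f k) <= \sum_(k <- r) g k.
Proof.
move=> ur jr g0 hf hi.
have gj : g j0 <= \sum_(k <- r) g k.
  by rewrite (bigD1_seq j0) //= -[leLHS]addr0 lerD // sumr_ge0.
have : (2 * K)%:R * (\sum_(k <- r) f k) <=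
       \sum_(k <- r) g k + \sum_(k <- r | k == i0) g j0.
  rewrite mulr_sumr (big_mkcond (fun k => k == i0)) -big_split /= big_seq [leRHS]big_seq.
  apply: ler_sum => k kr; case: eqP => [->|/eqP ki]; last by rewrite addr0 hf.
  by rewrite -[leLHS]add0r lerD.
have : \sum_(k <- r | k == i0) g j0 <= g j0.
  rewrite -big_filter (_ : [seq k <- r | k == i0] = if i0 \in r then [:: i0] else [::]).
    by case: ifP => _; rewrite ?big_seq1 ?big_nil.
  rewrite (@eq_filter _ _ (pred1 i0)) //; elim: (r) ur => //= x s IH /andP[xs us].
  rewrite inE eq_sym (IH us); case: eqP => [->|] //=; by rewrite (negPf xs).
rewrite natrM; nra.
Qed.

Section Quadrants.
Variables (m : nat -> nat -> R) (M K : nat) (xup yup : bool).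
Hypothesis K0 : (0 < K)%N.
Hypothesis m_ge0 : forall k l, (k.+2 <= l)%N -> (l < M)%N -> 0 <= m k l.
Hypothesis m_left : forall k l, (k.+3 <= l)%N -> (l < M)%N ->
  lac_step xup (2 * K) (m k l) (m k.+1 l).
Hypothesis m_right : forall k l, (k.+2 <= l)%N -> (l.+1 < M)%N ->
  lac_step yup (2 * K) (m k l) (m k l.+1).

(* Cells touching the diagonal, where homogeneity gives no information, are left out. *)
Definition weight k l : R := if (k.+2 <= l)%N && (l < M)%N then m k l else 0.

(* The quadrant is the one whose corner cell at (x, y) is its largest cell. *)
Definition quadrant_sum x y : R :=
  \sum_(k <- half_line xup M x) \sum_(l <- half_line yup M y) weight k l.

Let w_ge0 k l : 0 <= weight k l.
Proof. by rewrite /weight; case: ifP => // /andP[? ?]; apply: m_ge0. Qed.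

Let K1 : 1 <= K%:R :> R. Proof. by rewrite ler1n. Qed.

Let weak (u v : R) : 0 <= u -> (2 * K)%:R * u <= v -> K%:R * u <= v.
Proof.
move=> u0; rewrite natrM -mulrA => H; have := mulr_ge0 (ler0n R K) u0; lra.
Qed.

Let weak1 (u v : R) : 0 <= u -> (2 * K)%:R * u <= v -> u <= v.
Proof. by move=> u0 /(weak u0); apply: le_trans; rewrite ler_peMl. Qed.

Let w_left k l : (k.+3 <= l)%N -> (l < M)%N ->
  if xup then (2 * K)%:R * weight k l <= weight k.+1 l
  else (2 * K)%:R * weight k.+1 l <= weight k l.
Proof.
move=> kl lM; rewrite /weight lM !andbT kl (ltnW kl).
have a0 := m_ge0 (ltnW kl) lM; have b0 := m_ge0 (k := k.+1) kl lM.
by have := m_left kl lM; rewrite /lac_step !ger0_norm.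
Qed.

Let w_right k l : (k.+2 <= l)%N -> (l.+1 < M)%N ->
  if yup then (2 * K)%:R * weight k l <= weight k l.+1
  else (2 * K)%:R * weight k l.+1 <= weight k l.
Proof.
move=> kl lM; rewrite /weight lM (ltnW lM) !andbT kl (leqW kl).
have a0 := m_ge0 kl (ltnW lM); have b0 := m_ge0 (leqW kl) lM.
by have := m_right kl lM; rewrite /lac_step !ger0_norm.
Qed.

Let w0 k l : (l < k.+2)%N -> weight k l = 0.
Proof. by move=> kl; rewrite /weight leqNgt kl. Qed.

Lemma quadrant_sum_left x y : (x.+4 <= y)%N -> (y <= M)%N ->
  lac_step xup K (quadrant_sum x y) (quadrant_sum x.+1 y).
Proof.
move=> xy yM; apply: half_line_step; [by move=> k; apply: sumr_ge0|lia|].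
move=> k; rewrite /half_line; case: (xup) (w_left) => wl.
  rewrite mem_index_iota /= => kx _; case: (yup) w_right => wr; last first.
    rewrite mulr_sumr big_seq [leRHS]big_seq; apply: ler_sum => l.
    by rewrite mem_index_iota => ?; apply: weak => //; apply: wl; lia.
  (* The cell (k, k+2) is exceptional, since its neighbour (k+1, k+2) is left out at the diagonal.
     It is bounded through (k, k+3) by (k+1, k+3). *)
  apply: (@ler_sum_exception _ _ _ _ k.+2 k.+3) => //.
  - exact: iota_uniq.
  - by rewrite mem_index_iota; lia.
  - move=> l; rewrite mem_index_iota => /= ly lk; case: (ltnP l k.+2) => kl.
      by rewrite w0 // mulr0.
    by apply: wl; lia.
  - apply: le_trans (wr k k.+2 (leqnn _) ltac:(lia)) _.
    by apply: weak1 => //; apply: wl; lia.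
rewrite mem_index_iota => kx kM.
rewrite mulr_sumr; apply: ler_sum => l _; apply: weak => //.
case: (ltnP l k.+3) => kl; first by rewrite w0 // mulr0.
case: (ltnP l M) => lM; first exact: wl.
by rewrite /weight (ltnNge l M) lM !andbF mulr0.
Qed.

Lemma quadrant_sum_right x y : (x.+4 <= y)%N -> (y < M)%N ->
  lac_step yup K (quadrant_sum x y) (quadrant_sum x y.+1).
Proof.
move=> xy yM; rewrite /quadrant_sum exchange_big [X in lac_step _ _ _ X]exchange_big.
apply: half_line_step => //; first by move=> l; apply: sumr_ge0.
move=> l; rewrite /half_line; case: (yup) (w_right) => wr.
  rewrite mem_index_iota /= => ly lM.
  rewrite mulr_sumr; apply: ler_sum => k _; apply: weak => //.
  case: (ltnP l k.+2) => kl; first by rewrite w0 // mulr0.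
  exact: wr.
rewrite mem_index_iota => ly lM; case: (xup) w_left => wl.
  rewrite mulr_sumr big_seq [leRHS]big_seq; apply: ler_sum => k.
  by rewrite mem_index_iota => ?; apply: weak => //; apply: wr; lia.
have [l' lE] : exists l', l = l'.+2 by exists l.-2; lia.
(* Here the exceptional cell is (l-1, l+1), as (l-1, l) is left out; it is bounded through (l-2,
   l+1) by (l-2, l). *)
apply: (@ler_sum_exception _ _ _ _ l.-1 l.-2) => //.
- exact: iota_uniq.
- by rewrite mem_index_iota; lia.
- move=> k; rewrite mem_index_iota => kM kl; case: (ltnP l k.+2) => kl'.
    by rewrite w0 ?mulr0 //; lia.
  exact: wr.
- rewrite lE /= in lM ly *.
  apply: le_trans (wr l' l'.+2 (leqnn _) ltac:(lia)).
  rewrite ler_wpM2l //; apply: weak1 => //; apply: wl; lia.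
Qed.

End Quadrants.

(** Two adjacent quadrants with the same corner form a half-plane, whose sum depends on one
    coordinate only. Passing to an adjacent quadrant thus costs a one-variable function and a sign;
    passing to the opposite one does it twice. *)
Lemma quadrant_sum_separable m M xup yup :
  exists u v (e : bool), forall x y, (x <= M)%N -> (y <= M)%N ->
    quadrant_sum m M true false x y =
      u x + v y + (-1) ^+ e * quadrant_sum m M xup yup x y.
Proof.
pose w := weight m M; rewrite /quadrant_sum /half_line -/w.
have splitL (f : nat -> R) x : (x <= M)%N ->
    \sum_(0 <= k < M) f k = \sum_(0 <= k < x) f k + \sum_(x <= k < M) f k.
  by move=> xM; rewrite (@big_cat_nat _ _ _ x).
have splitR x y : (y <= M)%N ->
    \sum_(0 <= k < x) \sum_(0 <= l < M) w k l = \sum_(0 <= k < x) \sum_(0 <= l < y) w k l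
    + \sum_(0 <= k < x) \sum_(y <= l < M) w k l.
  by move=> yM; rewrite -big_split /=; apply: eq_bigr => k _; apply: splitL.
have splitR' x y : (y <= M)%N ->
    \sum_(x <= k < M) \sum_(0 <= l < M) w k l = \sum_(x <= k < M) \sum_(0 <= l < y) w k l
    + \sum_(x <= k < M) \sum_(y <= l < M) w k l.
  by move=> yM; rewrite -big_split /=; apply: eq_bigr => k _; apply: splitL.
case: xup yup => -[].
- exists (fun x => \sum_(0 <= k < x) \sum_(0 <= l < M) w k l), (fun=> 0), true.
  by move=> x y xM yM; rewrite (splitR x y yM) expr1; ring.
- exists (fun=> 0), (fun=> 0), false => x y _ _; rewrite expr0; ring.
- exists (fun x => - \sum_(x <= k < M) \sum_(0 <= l < M) w k l),
    (fun y => \sum_(0 <= k < M) \sum_(y <= l < M) w k l), false.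
  by move=> x y xM yM; rewrite (splitR' x y yM) (splitL _ x xM) expr0; ring.
- exists (fun=> 0), (fun y => \sum_(0 <= k < M) \sum_(y <= l < M) w k l), true.
  by move=> x y xM yM; rewrite (splitL _ x xM) expr1; ring.
Qed.

(** The rectangles telescope. For this quadrant [k < x < y <= l], so no cell touches the diagonal
    and [weight] never truncates. *)
Lemma quadrant_sum_rect h M x y : (x < y)%N -> (y <= M)%N ->
  h x y = h x M + h 0%N y - h 0%N M
    - quadrant_sum (fun k l => rect h k k.+1 l l.+1) M true false x y.
Proof.
move=> xy yM; rewrite /quadrant_sum /half_line.
rewrite (eq_big_nat _ _ (F2 := fun k => (h k.+1 M - h k.+1 y) - (h k M - h k y))).
  by rewrite telescope_sumr //; ring.
move=> k kx.
rewrite (eq_big_nat _ _ (F2 := fun l => (h k.+1 l.+1 - h k l.+1) - (h k.+1 l - h k l))).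
  by rewrite telescope_sumr //; ring.
by move=> l ly; rewrite /weight ifT /rect; [ring|lia].
Qed.

(** * Splitting off one-variable functions *)

Lemma lacunary_decomposition_pos h K M (xup yup : bool) :
  (0 < K)%N ->
  (forall a b c d, (a < b)%N -> (b < c)%N -> (c < d)%N -> (d <= 8 * K * M)%N ->
    0 <= rect h a b c d) ->
  (forall a b c d e, (a < b)%N -> (b < c)%N -> (c < d)%N -> (d < e)%N ->
    (e <= 8 * K * M)%N ->
    if xup then rect h a b d e <= rect h b c d e
    else rect h b c d e <= rect h a b d e) ->
  (forall a b c d e, (a < b)%N -> (b < c)%N -> (c < d)%N -> (d < e)%N ->
    (e <= 8 * K * M)%N ->
    if yup then rect h a b c d <= rect h a b d e
    else rect h a b d e <= rect h a b c d) ->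
  exists u v (g : nat -> nat -> R), [/\ lacunary_left K M g, lacunary_right K M g &
    forall x y, (x < y)%N -> (y <= M)%N ->
      h (8 * K * x)%N (8 * K * y)%N = u x + v y + g x y].
Proof.
move=> K0 pos left right.
(* The sampling step [8 * K] is used in two parts: step [2 * K] makes the cells lacunary with factor
   [2 * K], and a further step 4 turns [x < y] into the distance 4 from the diagonal that the
   quadrant sums require. *)
pose h' x y := h (2 * K * x)%N (2 * K * y)%N.
pose m := cell h (2 * K).
have L0 : (0 < 2 * K)%N by lia.
have m_ge0 k l : (k.+2 <= l)%N -> (l < 4 * M)%N -> 0 <= m k l.
  move=> kl lM; apply: (cell_ge0 L0 pos) => //;
  rewrite (_ : 8 * K * M = 2 * K * (4 * M))%N ?leq_mul2l ?lM ?orbT //; lia.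
have m_left k l : (k.+3 <= l)%N -> (l < 4 * M)%N -> lac_step xup (2 * K) (m k l) (m k.+1 l).
  move=> kl lM; apply: (cell_left L0 pos left) => //;
  rewrite (_ : 8 * K * M = 2 * K * (4 * M))%N ?leq_mul2l ?lM ?orbT //; lia.
have m_right k l : (k.+2 <= l)%N -> (l.+1 < 4 * M)%N -> lac_step yup (2 * K) (m k l) (m k l.+1).
  move=> kl lM; apply: (cell_right L0 pos right) => //;
  rewrite (_ : 8 * K * M = 2 * K * (4 * M))%N ?leq_mul2l ?lM ?orbT //; lia.
have [u [v [e sepE]]] := quadrant_sum_separable m (4 * M) xup yup.
pose g x y := (-1) ^+ (~~ e) * quadrant_sum m (4 * M) xup yup (4 * x) (4 * y).
have lac_g up x y x' y' :
    lac_step up K (quadrant_sum m (4 * M) xup yup (4 * x) (4 * y))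
                  (quadrant_sum m (4 * M) xup yup (4 * x') (4 * y')) ->
    lac_step up K (g x y) (g x' y').
  by rewrite /lac_step /g !normrM !normrX !normrN1 !expr1n !mul1r.
exists (fun x => h' (4 * x)%N (4 * M)%N - h' 0%N (4 * M)%N - u (4 * x)%N),
  (fun y => h' 0%N (4 * y)%N - v (4 * y)%N), g; split.
- exists xup => x x' y xx' x'y yM; apply: lac_g.
  apply: (@lac_step_chain _ _ (fun z => quadrant_sum m (4 * M) xup yup z (4 * y))) => //;
    first by lia.
  by move=> z zx; apply: quadrant_sum_left => //; lia.
- exists yup => x y y' xy yy' y'M; apply: lac_g.
  apply: (@lac_step_chain _ _ (fun z => quadrant_sum m (4 * M) xup yup (4 * x) z)) => //;
    first by lia.
  by move=> z zx; apply: quadrant_sum_right => //; lia.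
move=> x y xy yM.
have -> : h (8 * K * x)%N (8 * K * y)%N = h' (4 * x)%N (4 * y)%N.
  by rewrite /h'; congr h; lia.
rewrite (@quadrant_sum_rect h' (4 * M)) //; [|lia|lia].
rewrite sepE; [|lia|lia]; rewrite /g.
by case: (e) => /=; rewrite ?expr0 ?expr1; ring.
Qed.

(** The sign of the rectangles and the directions [xup] and [yup]. Two rectangles with one side in
    common and adjacent other sides, or nested ones, take five points; absolute values make the last
    two bits independent of the sign. *)
Definition rect_pattern h (s : seq nat) : bool * bool * bool :=
  let p := nth 0%N s in
  (0 <= rect h (p 0%N) (p 1%N) (p 2%N) (p 3%N),
   `|rect h (p 0%N) (p 1%N) (p 3%N) (p 4%N)| <= `|rect h (p 1%N) (p 2%N) (p 3%N) (p 4%N)|,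
   `|rect h (p 0%N) (p 1%N) (p 2%N) (p 3%N)| <= `|rect h (p 0%N) (p 1%N) (p 3%N) (p 4%N)|).

Lemma lacunary_decomposition h K M pat :
  (0 < K)%N ->
  (forall a b c d e, (a < b)%N -> (b < c)%N -> (c < d)%N -> (d < e)%N ->
    (e <= (8 * K * M).+1)%N -> rect_pattern h [:: a; b; c; d; e] = pat) ->
  exists u v (g : nat -> nat -> R), [/\ lacunary_left K M g, lacunary_right K M g &
    forall x y, (x < y)%N -> (y <= M)%N ->
      h (8 * K * x)%N (8 * K * y)%N = u x + v y + g x y].
Proof.
move=> K0; case: pat => -[sgn xup] yup hom.
pose h1 x y := (-1) ^+ (~~ sgn) * h x y.
have rectE a b c d : rect h1 a b c d = (-1) ^+ (~~ sgn) * rect h a b c d.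
  by rewrite /rect /h1; ring.
have nrectE a b c d : `|rect h1 a b c d| = `|rect h a b c d|.
  by rewrite rectE normrM normrX normrN1 expr1n mul1r.
have pos a b c d : (a < b)%N -> (b < c)%N -> (c < d)%N -> (d <= 8 * K * M)%N ->
    0 <= rect h1 a b c d.
  (* The sign of a four-point rectangle is read off a five-point pattern, with [d.+1] as filler;
     hence the extra point in the range of [hom]. *)
  move=> ab bc cd dM; have [+ _ _] := hom a b c d d.+1 ab bc cd (ltnSn d) ltac:(lia).
  rewrite /= rectE; case: (sgn) => /= [|/negbT]; first by rewrite mul1r.
  by rewrite -ltNge expr1 mulN1r oppr_ge0 => /ltW.
have [||u [v [g [gl gr hE]]]] := @lacunary_decomposition_pos h1 K M xup yup K0 pos.
- move=> a b c d e ab bc cd de eM; have [_ + _] := hom a b c d e ab bc cd de ltac:(lia).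
  rewrite /= -!nrectE !ger0_norm ?pos //; try lia.
  by case: (xup) => [->//|/negbT]; rewrite -ltNge => /ltW.
- move=> a b c d e ab bc cd de eM; have [_ _ +] := hom a b c d e ab bc cd de ltac:(lia).
  rewrite /= -!nrectE !ger0_norm ?pos //; try lia.
  by case: (yup) => [->//|/negbT]; rewrite -ltNge => /ltW.
pose s : R := (-1) ^+ (~~ sgn).
have lac_s up x y : lac_step up K x y -> lac_step up K (s * x) (s * y).
  by rewrite /lac_step /s !normrM !normrX !normrN1 !expr1n !mul1r.
exists (fun x => s * u x), (fun y => s * v y), (fun x y => s * g x y); split.
- by have [up hg] := gl; exists up => x x' y *; apply: lac_s; apply: hg.
- by have [up hg] := gr; exists up => x y y' *; apply: lac_s; apply: hg.
move=> x y xy yM; rewrite -!mulrDr -hE // /h1 /s.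
by case: (sgn); rewrite ?expr0 ?expr1; ring.
Qed.

Definition increment_pattern f (s : seq nat) : bool * bool :=
  let p := nth 0%N s in
  (f (p 0%N) <= f (p 1%N), `|f (p 1%N) - f (p 0%N)| <= `|f (p 2%N) - f (p 1%N)|).

Lemma lacunary_unary_pattern f K M pat :
  (0 < K)%N ->
  (forall a b c, (a < b)%N -> (b < c)%N -> (c <= (K * M).+1)%N ->
    increment_pattern f [:: a; b; c] = pat) ->
  exists c, lacunary K M (fun x => f (K * x)%N - c).
Proof.
move=> K0; case: pat => sgn up hom.
pose f1 x := (-1) ^+ (~~ sgn) * f x.
have mono x y : (x <= y)%N -> (y <= K * M)%N -> f1 x <= f1 y.
  rewrite leq_eqVlt => /orP[/eqP->//|xy] yM.
  have [+ _] := hom x y y.+1 xy (ltnSn _) ltac:(lia).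
  rewrite /= /f1; case: (sgn) => /= [|/negbT]; first by rewrite !mul1r.
  by rewrite -ltNge expr1 !mulN1r lerN2 => /ltW.
have [|c [up' hc]] := @lacunary_unary K M f1 up K0 mono.
  move=> a b c _ ab bc cM; have [_ +] := hom a b c ab bc ltac:(lia).
  have nE x y : `|f x - f y| = `|f1 x - f1 y|.
    by rewrite /f1 -mulrBr normrM normrX normrN1 expr1n mul1r.
  rewrite /= !nE !ger0_norm ?subr_ge0 ?mono //; try lia.
  by case: (up) => [->//|/negbT]; rewrite -ltNge => /ltW.
exists ((-1) ^+ (~~ sgn) * c); exists up' => x x' xx' x'M.
have E z : f (K * z)%N - (-1) ^+ (~~ sgn) * c = (-1) ^+ (~~ sgn) * (f1 (K * z)%N - c).
  by rewrite /f1; case: (sgn); rewrite ?expr0 ?expr1; ring.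
by have := hc x x' xx' x'M; rewrite /lac_step !E !normrM !normrX !normrN1 !expr1n !mul1r.
Qed.

End Lacunarity.

(** * Sums of terms *)

Section Terms.
Variables (R : realFieldType) (r : nat).

Definition increasing_tuple M (x : 'I_r -> nat) : Prop :=
  (forall i j : 'I_r, (i < j)%N -> (x i < x j)%N) /\ (forall i, (x i < M)%N).

(** [None] stands for the constant and [(i, i)] for the function of the variable [i]. Pairs in
    decreasing order are padding with zero term. *)
Definition term_index : finType := option ('I_r * 'I_r).

Definition term_support (e : term_index) : {set 'I_r} :=
  if e is Some p then [set p.1; p.2] else set0.

Definition proper_index (e : term_index) : bool :=
  if e is Some p then (p.1 <= p.2)%N else true.

Lemma term_support_inj e e' : proper_index e -> proper_index e' -> e != e' ->
  exists i, (i \in term_support e) != (i \in term_support e').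
Proof.
move=> pe pe' ne; apply/existsP; apply: contraNT ne => /existsPn eqs.
have {}eqs i : (i \in term_support e) = (i \in term_support e').
  by apply/eqP; rewrite -[_ == _]negbK.
case: e e' pe pe' eqs => [[i j]|] [[i' j']|] //= ij ij' eqs.
- have [] := (eqs i, eqs j); have [] := (eqs i', eqs j'); rewrite !inE !eqxx ?orbT.
  have E (u v : 'I_r) : (u == v) = (nat_of_ord u == nat_of_ord v) by [].
  rewrite !E => {E}.
  move=> h1 h2 h3 h4; apply/eqP; congr (Some (_, _)); apply: ord_inj; lia.
- by have := eqs i; rewrite !inE eqxx.
- by have := eqs i'; rewrite !inE eqxx.
Qed.

Variables (c : R) (a : 'I_r -> nat -> R) (g : 'I_r -> 'I_r -> nat -> nat -> R).

Definition term (e : term_index) (x : 'I_r -> nat) : R :=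
  if e is Some p then
    if p.1 == p.2 then a p.1 (x p.1)
    else if (p.1 < p.2)%N then g p.1 p.2 (x p.1) (x p.2) else 0
  else c.

Lemma term_eq_on e x y : (forall i, i \in term_support e -> x i = y i) -> term e x = term e y.
Proof.
case: e => [[i j]|] //= eqs.
by rewrite !eqs // !inE eqxx ?orbT.
Qed.

Lemma term_improper e x : ~~ proper_index e -> term e x = 0.
Proof.
case: e => [[i j]|] //=; rewrite -ltnNge => ji.
by rewrite ifF ?ifF //; [lia|apply/eqP=> ij; move: ji; rewrite ij ltnn].
Qed.

Definition moved (x y : 'I_r -> nat) i : Prop := (x i < y i)%N /\ forall j, j != i -> y j = x j.

Lemma term_lacunary K M e i :
  (forall i, lacunary K M (a i)) ->
  (forall i j : 'I_r, (i < j)%N -> lacunary_left K M (g i j) /\ lacunary_right K M (g i j)) ->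
  proper_index e -> i \in term_support e ->
  exists up, forall x y, increasing_tuple M x -> increasing_tuple M y -> moved x y i ->
    lac_step up K (term e x) (term e y).
Proof.
move=> la lg; case: e => [[j k]|]; rewrite ?inE //= => jk ijk.
have [jkE|njk] := eqVneq j k.
  have ij : i = j by move: ijk; rewrite -jkE orbb => /eqP.
  have [up hup] := la j; exists up => x y _ [_ yM] [xy _].
  by apply: hup; rewrite -?ij.
have {}jk : (j < k)%N by move: jk; rewrite leq_eqVlt val_eqE (negPf njk).
rewrite jk; have [gl gr] := lg j k jk.
case/orP: ijk => /eqP ij.
  have [up hup] := gl; exists up => x y [_ xM] [yi yM] [xy hxy].
  rewrite (hxy k); last by rewrite ij eq_sym.
  apply: hup; rewrite -?ij //; rewrite -(hxy k) ?ij 1?eq_sym //; exact: yi.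
have [up hup] := gr; exists up => x y [xi xM] [yi yM] [xy hxy].
rewrite (hxy j); last by rewrite ij.
by apply: hup; rewrite -?ij //; apply: xi; rewrite ij.
Qed.

(* The points 3 * t i + 1 leave room to move any variable by one in either direction. *)
Lemma term_dominated K M n e e' t :
  (forall i, lacunary K M (a i)) ->
  (forall i j : 'I_r, (i < j)%N -> lacunary_left K M (g i j) /\ lacunary_right K M (g i j)) ->
  proper_index e -> proper_index e' -> e != e' ->
  (forall x, increasing_tuple M x -> `|term e' x| <= `|term e x|) ->
  (3 * n <= M)%N -> increasing_tuple n t ->
  K%:R * `|term e' (fun i => 3 * t i + 1)%N| <= `|term e (fun i => 3 * t i + 1)%N|.
Proof.
move=> la lg pe pe' ne le nM [ti tn]; set x := fun i => _.
have [i hi] := term_support_inj pe pe' ne.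
pose y d j := (if j == i then 3 * t j + d else x j)%N.
have xi : increasing_tuple M x.
  split=> [j k jk|j]; rewrite /x; first by have := ti j k jk; lia.
  by have := tn j; lia.
have yi d : (d <= 2)%N -> increasing_tuple M (y d).
  move=> d2; split=> [j k jk|j]; rewrite /y /x.
    by have := ti j k jk; case: ifP; case: ifP; lia.
  by have := tn j; case: ifP; lia.
have mv0 : moved (y 0%N) x i.
  by split=> [|j ji]; rewrite /y /x ?eqxx ?(negPf ji) //; lia.
have mv2 : moved x (y 2%N) i.
  by split=> [|j ji]; rewrite /y /x ?eqxx ?(negPf ji) //; lia.
have indep e1 d : i \notin term_support e1 -> term e1 (y d) = term e1 x.
  move=> ie; apply: term_eq_on => j je; rewrite /y ifF //.
  by apply/eqP => ji; move: ie; rewrite -ji je.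
(* If [i] occurs only in [e], it is moved so that [e] shrinks by the factor [K], and the unchanged
   [e'] is still no larger. If it occurs only in [e'], it is moved so that [e'] grows. *)
case: (boolP (i \in term_support e)) hi => ie; case: (boolP (i \in term_support e')) => ie' // _.
  have [up hup] := term_lacunary la lg pe ie.
  pose d := if up then 0%N else 2%N.
  have d2 : (d <= 2)%N by rewrite /d; case: (up).
  have yx : K%:R * `|term e (y d)| <= `|term e x|.
    rewrite /d; case: up hup {d d2} => hup; [exact: (hup _ _ (yi 0%N isT) xi mv0)|].
    exact: (hup _ _ xi (yi 2%N isT) mv2).
  apply: le_trans yx; rewrite ler_wpM2l // -(indep e' d ie').
  exact: le (yi d d2).
have [up hup] := term_lacunary la lg pe' ie'.
pose d := if up then 2%N else 0%N.
have d2 : (d <= 2)%N by rewrite /d; case: (up).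
rewrite -(indep e d ie); apply: le_trans (le _ (yi d d2)).
rewrite /d; case: up hup {d d2} => hup; [exact: (hup _ _ xi (yi 2%N isT) mv2)|].
exact: (hup _ _ (yi 0%N isT) xi mv0).
Qed.

(** A proper term that is largest at the reference tuple [t0] is largest at every tuple, by
    homogeneity, and so dominates all others by the factor [K]. As [K] exceeds the number of terms,
    the rest cannot reverse its sign; if it vanishes, so does the rest. *)
Lemma term_sum_sign K M n :
  (r * r + 1 < K)%N ->
  (forall i, lacunary K M (a i)) ->
  (forall i j : 'I_r, (i < j)%N -> lacunary_left K M (g i j) /\ lacunary_right K M (g i j)) ->
  (forall e e' x y, increasing_tuple M x -> increasing_tuple M y ->
    (`|term e' x| <= `|term e x|) = (`|term e' y| <= `|term e y|) /\
    (term e x <= 0) = (term e y <= 0)) ->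
  (3 * n <= M)%N -> (r <= n)%N ->
  exists v, forall t, increasing_tuple n t ->
    (\sum_e term e (fun i => 3 * t i + 1)%N <= 0) = v.
Proof.
move=> Kbig la lg hom nM rn.
have spaced t : increasing_tuple n t -> increasing_tuple M (fun i => 3 * t i + 1)%N.
  move=> [ti tn]; split=> [j k jk|j]; first by have := ti j k jk; lia.
  by have := tn j; lia.
pose t0 (i : 'I_r) : nat := i; have t0i : increasing_tuple n t0.
  by split=> // i; apply: leq_trans (ltn_ord i) rn.
set x0 := (fun i => 3 * t0 i + 1)%N.
have x0i := spaced _ t0i; rewrite -/x0 in x0i.
case: (@Order.TotalTheory.arg_maxP _ _ _ None proper_index
  (fun e => `|term e x0|)) => // e0 pe0 max0.
exists (term e0 x0 <= 0) => t ti; set x : 'I_r -> nat := (fun i => 3 * t i + 1)%N.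
have xi := spaced _ ti; rewrite -/x in xi.
have dom e : e != e0 -> K%:R * `|term e x| <= `|term e0 x|.
  move=> ne; case: (boolP (proper_index e)) => pe; last first.
    by rewrite term_improper // normr0 mulr0.
  apply: (@term_dominated K M n e0 e) => //; first by rewrite eq_sym.
  by move=> y yi; rewrite -((hom e0 e x0 y x0i yi).1); apply: max0.
rewrite ((hom e0 e0 x0 x x0i xi).2) (bigD1 e0) //=.
set s := \sum_(e | _) _.
have cardE : (#|{: term_index}| = r * r + 1)%N by rewrite card_option card_prod card_ord addn1.
have sle : K%:R * `|s| <= (r * r + 1)%:R * `|term e0 x|.
  apply: le_trans (_ : K%:R * \sum_(e | e != e0) `|term e x| <= _).
    by rewrite ler_wpM2l // ler_norm_sum.
  rewrite mulr_sumr -cardE -sum1_card natr_sum mulr_suml big_mkcond /=.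
  apply: ler_sum => e _; rewrite mul1r; case: ifP => // ne; exact: dom.
have Kr : (r * r + 1)%:R + 1 <= K%:R :> R by rewrite natr1 ler_nat.
have q0 : 0 <= (r * r + 1)%:R :> R by apply: ler0n.
have s0 := normr_ge0 s.
have sle' : ((r * r + 1)%:R + 1) * `|s| <= (r * r + 1)%:R * `|term e0 x|.
  by apply: le_trans sle; rewrite ler_wpM2r.
have s1 : s <= `|s| by apply: ler_norm.
have s2 : - `|s| <= s by rewrite lerNl -normrN ler_norm.
move: (_%:R) q0 sle' {sle Kr} => q q0 sle'.
case: (lerP (term e0 x) 0) sle' => T0.
  by rewrite (ler0_norm T0) => H; apply/idP; nra.
by rewrite (gtr0_norm T0) => H; apply/negbTE; rewrite -ltNge; nra.
Qed.

End Terms.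

(** The values on [U] are listed in increasing order and padded to length four by [M, M + 1, ...],
    which explains the range [M + 4]. The position map [rho] depends on [U] alone, so it can be part
    of the colour index. *)
Lemma increasing_tuple_code r (U : {set 'I_r}) : (#|U| <= 4)%N ->
  exists rho : {ffun 'I_r -> 'I_4}, forall M x, increasing_tuple M x ->
    exists s, [/\ sorted ltn s, size s = 4, all (fun y => y < M + 4)%N s &
      forall i, i \in U -> nth 0%N s (rho i) = x i].
Proof.
move=> U4; exists [ffun i => inord (index i (enum U))] => M x [xi xM].
have sz : size (map x (enum U)) = #|U| by rewrite size_map -cardE.
exists (take 4 (map x (enum U) ++ iota M 4)); split.
- apply: take_sorted; rewrite sorted_pairwise; last exact: ltn_trans.
  rewrite pairwise_cat -[pairwise _ (iota _ _)]sorted_pairwise; last exact: ltn_trans.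
  rewrite iota_ltn_sorted andbT; apply/andP; split.
    apply/allrelP => y z /mapP[i _ ->]; rewrite mem_iota => /andP[+ _].
    exact: leq_trans (xM i).
  rewrite pairwise_map /enum_mem -enumT; apply: pairwise_filter.
  have : pairwise ltn (map val (enum 'I_r)).
    by rewrite val_enum_ord -sorted_pairwise ?iota_ltn_sorted //; exact: ltn_trans.
  by rewrite pairwise_map; apply: sub_pairwise => i j /= /xi.
- by rewrite size_take size_cat sz size_iota; case: ltngtP => //; lia.
- apply/allP => y /mem_take; rewrite mem_cat => /orP[/mapP[i _ ->]|].
    by apply: leq_trans (xM i) _; rewrite leq_addr.
  by rewrite mem_iota => /andP[_].
move=> i iU; have ii : (index i (enum U) < #|U|)%N by rewrite cardE index_mem mem_enum.
rewrite ffunE inordK; last by apply: leq_trans U4.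
rewrite nth_take; last by apply: leq_trans U4.
rewrite nth_cat sz ii (nth_map i) -?cardE //.
by rewrite nth_index // mem_enum.
Qed.

(** * Combining the three Ramsey stages *)

Section Assembly.
Variables (R : realFieldType) (r : nat).

Definition lac_factor : nat := (r * r).+2.

Definition colours_pair : nat := #|{ffun 'I_r * 'I_r -> bool * bool * bool}|.
Definition colours_single : nat := #|{ffun 'I_r -> bool * bool}|.
Definition colours_term : nat :=
  #|{ffun term_index r * term_index r * {ffun 'I_r -> 'I_4} -> bool * bool}|.

(** Points spaced by 3 for tuples below [n + r], and 4 more as padding for
    [increasing_tuple_code]. *)
Definition points_term n : nat := 3 * n + (3 * r + 4).
Definition points_single n : nat :=
  lac_factor * ramsey_bound colours_term 3 (points_term n) + 2.
Definition points_pair n : nat :=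
  8 * lac_factor * ramsey_bound colours_single 2 (points_single n) + 2.
Definition points_needed n : nat := ramsey_bound colours_pair 4 (points_pair n).

(** The heights are 1, 4, 6, 10. They start at 1 because powers are absorbed only below an
    exponential. *)
Lemma points_needed_bounded : tower_bounded 10 points_needed.
Proof.
apply: (@tower_bounded_ramsey 5); apply: tower_bounded_affine.
apply: (@tower_bounded_ramsey 3); apply: tower_bounded_affine.
apply: (@tower_bounded_ramsey 0); apply: tower_bounded_affine.
by exists 1%N => // n _; rewrite mul1n /= ltnW // ltn_expl.
Qed.

Lemma lacunary_sub K M (f : nat -> R) b P : increasing_below b P M ->
  lacunary K M f -> lacunary K P (f \o b).
Proof.
move=> [b1 b2] [up hf]; exists up => x y xy yP /=; apply: hf; last exact: b2.
by apply: b1; rewrite xy.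
Qed.

Lemma lacunary_left_sub K M (f : nat -> nat -> R) b P : increasing_below b P M ->
  lacunary_left K M f -> lacunary_left K P (fun x y => f (b x) (b y)).
Proof.
move=> [b1 b2] [up hf]; exists up => x x' y xx' x'y yP /=; apply: hf; last exact: b2.
  by apply: b1; rewrite xx' (ltn_trans x'y).
by apply: b1; rewrite x'y.
Qed.

Lemma lacunary_right_sub K M (f : nat -> nat -> R) b P : increasing_below b P M ->
  lacunary_right K M f -> lacunary_right K P (fun x y => f (b x) (b y)).
Proof.
move=> [b1 b2] [up hf]; exists up => x y y' xy yy' y'P /=; apply: hf; last exact: b2.
  by apply: b1; rewrite xy (ltn_trans yy').
by apply: b1; rewrite yy'.
Qed.

Lemma increasing_below_mul k P M : (0 < k)%N -> (k * P <= M + k.-1)%N ->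
  increasing_below (fun x => k * x)%N P M.
Proof.
move=> k0 kM; split=> [i j /andP[ij jP]|i iP]; first by rewrite ltn_pmul2l.
have : (k * i.+1 <= k * P)%N by rewrite leq_mul2l iP orbT.
by rewrite mulnS; lia.
Qed.

Lemma pair_stage (h : 'I_r -> 'I_r -> nat -> nat -> R) M N :
  (ramsey_bound colours_pair 4 (8 * lac_factor * M + 2) <= N)%N ->
  exists b u v (g : 'I_r * 'I_r -> nat -> nat -> R), increasing_below b M N /\
    forall p, [/\ lacunary_left lac_factor M (g p), lacunary_right lac_factor M (g p) &
      forall x y, (x < y)%N -> (y < M)%N ->
        h p.1 p.2 (b x) (b y) = u p x + v p y + g p x y].
Proof.
set K := lac_factor; set P := (8 * K * M + 2)%N => le.
have K0 : (0 < K)%N by [].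
have [a [aP hom]] := ramsey_reindex (fun p s => rect_pattern (h p.1 p.2) s) le.
have ex p : exists uvg : (nat -> R) * (nat -> R) * (nat -> nat -> R),
    [/\ lacunary_left K M uvg.2, lacunary_right K M uvg.2 &
      forall x y, (x < y)%N -> (y <= M)%N ->
        h p.1 p.2 (a (8 * K * x)%N) (a (8 * K * y)%N) = uvg.1.1 x + uvg.1.2 y + uvg.2 x y].
  pose h' x y := h p.1 p.2 (a x) (a y).
  pose pat := rect_pattern h' [:: 0; 1; 2; 3; 4]%N.
  have [|u [v [g hg]]] := @lacunary_decomposition R h' K M pat K0; last by exists (u, v, g).
  (* The reference tuple 0, ..., 4 fits only if [M > 0]; for [M = 0] the range holds no five
     points. *)
  have [M0|M0] := posnP M.
    by rewrite M0 muln0 => a0 b0 c0 d0 e0 *; exfalso; lia.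
  move=> x0 x1 x2 x3 x4 h01 h12 h23 h34 h4.
  have := hom p [:: x0; x1; x2; x3; x4] [:: 0; 1; 2; 3; 4]%N.
  apply => //=; rewrite ?h01 ?h12 ?h23 //=; rewrite /P; nia.
have [f hf] := fin_all_exists ex.
exists (fun x => a (8 * K * x)%N), (fun p => (f p).1.1), (fun p => (f p).1.2), (fun p => (f p).2).
split.
  apply: (increasing_below_comp aP); apply: increasing_below_mul; rewrite ?muln_gt0 //.
  by rewrite /P; lia.
by move=> p; have [? ? hE] := hf p; split=> // x y xy yM; apply: hE => //; exact: ltnW.
Qed.

Lemma single_stage (f : 'I_r -> nat -> R) M N :
  (ramsey_bound colours_single 2 (lac_factor * M + 2) <= N)%N ->
  exists b c, increasing_below b M N /\
    forall i, lacunary lac_factor M (fun x => f i (b x) - c i).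
Proof.
set K := lac_factor; set P := (K * M + 2)%N => le.
have K0 : (0 < K)%N by [].
have [a [aP hom]] := ramsey_reindex (fun i s => increment_pattern (f i) s) le.
have ex i : exists c, lacunary K M (fun x => f i (a (K * x)%N) - c).
  pose f' x := f i (a x).
  apply: (@lacunary_unary_pattern R f' K M (increment_pattern f' [:: 0; 1; 2]%N)) => //.
  have [M0|M0] := posnP M.
    by rewrite M0 muln0 => a0 b0 c0 *; exfalso; lia.
  move=> x0 x1 x2 h01 h12 h2.
  have := hom i [:: x0; x1; x2] [:: 0; 1; 2]%N.
  apply => //=; rewrite ?h01 ?h12 //=; rewrite /P; nia.
have [c hc] := fin_all_exists ex.
exists (fun x => a (K * x)%N), c; split=> //.
apply: (increasing_below_comp aP); apply: increasing_below_mul => //.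
by rewrite /P; lia.
Qed.

Lemma sum_transpose (f : 'I_r -> 'I_r -> R) :
  \sum_(i < r) \sum_(j < r | (j < i)%N) f i j = \sum_(i < r) \sum_(j < r | (i < j)%N) f j i.
Proof. by rewrite (exchange_big_dep xpredT). Qed.

Lemma sum_trichotomy (f : 'I_r -> 'I_r -> R) :
  \sum_i \sum_j f i j =
    \sum_i f i i + \sum_(i < r) \sum_(j < r | (i < j)%N) (f i j + f j i).
Proof.
have -> : \sum_(i < r) \sum_(j < r | (i < j)%N) (f i j + f j i) =
    \sum_(i < r) \sum_(j < r | (i < j)%N) f i j + \sum_(i < r) \sum_(j < r | (i < j)%N) f j i.
  by rewrite -big_split; apply: eq_bigr => i _; rewrite -big_split.
rewrite -(sum_transpose f) -!big_split; apply: eq_bigr => i _ /=.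
rewrite (bigD1 i) //=; congr (_ + _).
rewrite (bigID (fun j : 'I_r => (i < j)%N)) /=; congr (_ + _); apply: eq_bigl => j;
  have -> : (j != i) = (nat_of_ord j != i) by []; lia.
Qed.

Lemma sum_term c a (g : 'I_r -> 'I_r -> nat -> nat -> R) x :
  \sum_e term c a g e x =
    c + \sum_i a i (x i) + \sum_(i < r) \sum_(j < r | (i < j)%N) g i j (x i) (x j).
Proof.
rewrite (bigD1 None) //= -addrA; congr (_ + _).
rewrite (reindex_omap Some id) /=; last by case.
rewrite (eq_bigl xpredT); last by move=> p; rewrite eqxx.
rewrite -(pair_bigA _ (fun i j => term c a g (Some (i, j)) x)) /= sum_trichotomy.
congr (_ + _); first by apply: eq_bigr => i _; rewrite eqxx.
apply: eq_bigr => i _; apply: eq_bigr => j ij.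
have /negPf nij : i != j by apply: contraTneq ij => ->; rewrite ltnn.
by rewrite nij eq_sym nij ij ltnNge (ltnW ij) addr0.
Qed.

Theorem pair_sum_ramsey n N (h : 'I_r -> 'I_r -> nat -> nat -> R) :
  (points_needed n <= N)%N ->
  exists b, increasing_below b n N /\ exists v, forall t, increasing_tuple n t ->
    (\sum_i \sum_j h i j (b (t i)) (b (t j)) <= 0) = v.
Proof.
set K := lac_factor => le.
(* Both orders of a pair are added up, so that each pair of variables gives a single term. *)
have [b1 [u [v [g [b1P hg]]]]] :=
  @pair_stage (fun i j x y => h i j x y + h j i y x) _ _ le.
(* [A i] gathers everything that depends on the variable [i] alone: the diagonal summand and the
   parts split off from pairs with [i] as smaller or larger index. *)
pose A i x := h i i (b1 x) (b1 x) + \sum_(j < r | (i < j)%N) u (i, j) x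
  + \sum_(j < r | (j < i)%N) v (j, i) x.
have [b2 [c [b2P ha]]] := @single_stage A (ramsey_bound colours_term 3 (points_term n)) _ (leqnn _).
pose T := term (\sum_i c i) (fun i x => A i (b2 x) - c i)
  (fun i j x y => g (i, j) (b2 x) (b2 y)).
pose val4 (rho : {ffun 'I_r -> 'I_4}) s i := nth 0%N s (rho i).
have [b3 [b3P hom]] := @ramsey_reindex
  (term_index r * term_index r * {ffun 'I_r -> 'I_4})%type _ 3
  (fun q s => (`|T q.1.2 (val4 q.2 s)| <= `|T q.1.1 (val4 q.2 s)|, T q.1.1 (val4 q.2 s) <= 0))
  (points_term n) _ (leqnn _).
set M := (points_term n - 4)%N.
have ME : (M + 4)%N = points_term n by rewrite /M /points_term; lia.
have b3M : increasing_below b3 M (ramsey_bound colours_term 3 (points_term n)).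
  by have [p q] := b3P; split=> [i j|i] H; [apply: p|apply: q]; lia.
have TE e x : term (\sum_i c i) (fun i x => A i (b2 (b3 x)) - c i)
    (fun i j x y => g (i, j) (b2 (b3 x)) (b2 (b3 y))) e x = T e (b3 \o x).
  by case: e.
(* The bound [n + r] leaves room for the reference tuple 0, ..., r - 1 even when [n < r]. *)
have [||||||w hw] := @term_sum_sign R r (\sum_i c i) (fun i x => A i (b2 (b3 x)) - c i)
    (fun i j x y => g (i, j) (b2 (b3 x)) (b2 (b3 y))) K M (n + r).
- by rewrite addn1.
- by move=> i; apply: (@lacunary_sub _ _ (fun x => A i (b2 x) - c i) _ _ b3M).
- move=> i j ij; have [gl gr _] := hg (i, j).
  split.
    apply: (@lacunary_left_sub _ _ (fun x y => g (i, j) (b2 x) (b2 y)) _ _ b3M).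
    exact: (lacunary_left_sub b2P).
  apply: (@lacunary_right_sub _ _ (fun x y => g (i, j) (b2 x) (b2 y)) _ _ b3M).
  exact: (lacunary_right_sub b2P).
- move=> e e' x y xi yi; rewrite !TE.
  have [|rho hrho] := @increasing_tuple_code r (term_support e :|: term_support e').
    apply: leq_trans (leq_card_setU _ _) _.
    have s2 (e1 : term_index r) : (#|term_support e1| <= 2)%N.
      by case: e1 => [[i j]|] /=; rewrite ?cards0 // cards2; case: eqP.
    by have := s2 e; have := s2 e'; lia.
  have [s [so sz al hs]] := hrho M x xi.
  have [s' [so' sz' al' hs']] := hrho M y yi.
  rewrite ME in al al'.
  have val4E e1 z s1 : size s1 = 4 -> term_support e1 \subset term_support e :|: term_support e' ->
      (forall i, i \in term_support e :|: term_support e' -> nth 0%N s1 (rho i) = z i) ->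
      T e1 (b3 \o z) = T e1 (val4 rho (map b3 s1)).
    move=> sz1 sub H; apply: term_eq_on => i /(subsetP sub) iU.
    by rewrite /val4 (nth_map 0%N) ?sz1 // H.
  rewrite !(val4E _ x s) ?subsetUl ?subsetUr // !(val4E _ y s') ?subsetUl ?subsetUr //.
  by case: (hom (e, e', rho) s s' so so' sz sz' al al').
- by rewrite /M /points_term; lia.
- by rewrite leq_addl.
exists (fun x => b1 (b2 (b3 (3 * x + 1)%N))); split.
  have b4P : increasing_below (fun x => 3 * x + 1)%N n M.
    by split=> *; rewrite /M /points_term; lia.
  exact: (increasing_below_comp b1P (increasing_below_comp b2P (increasing_below_comp b3M b4P))).
exists w => t [ti tn]; rewrite -(hw t); last first.
  by split=> // i; apply: leq_trans (tn i) (leq_addr _ _).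
congr (_ <= 0); rewrite sum_term; set X : 'I_r -> nat := fun i => b2 (b3 (3 * t i + 1)%N).
have Xi (i j : 'I_r) : (i < j)%N -> (X i < X j)%N.
  move=> ij; apply: b2P.1; rewrite b3M.2 ?andbT; last first.
    by have := tn j; rewrite /M /points_term; lia.
  apply: b3M.1; have := ti i j ij; have := tn j; rewrite /M /points_term; lia.
have XM i : (X i < ramsey_bound colours_single 2 (points_single n))%N.
  by apply/b2P.2/b3M.2; have := tn i; rewrite /M /points_term; lia.
rewrite sum_trichotomy.
have -> : \sum_(i < r) \sum_(j < r | (i < j)%N)
    (h i j (b1 (X i)) (b1 (X j)) + h j i (b1 (X j)) (b1 (X i))) =
    \sum_(i < r) \sum_(j < r | (i < j)%N)
      (u (i, j) (X i) + v (i, j) (X j) + g (i, j) (X i) (X j)).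
  apply: eq_bigr => i _; apply: eq_bigr => j ij; have [_ _ hE] := hg (i, j).
  by rewrite -hE //; exact: Xi.
have splitE : \sum_(i < r) \sum_(j < r | (i < j)%N)
    (u (i, j) (X i) + v (i, j) (X j) + g (i, j) (X i) (X j)) =
    \sum_(i < r) \sum_(j < r | (i < j)%N) u (i, j) (X i)
    + \sum_(i < r) \sum_(j < r | (j < i)%N) v (j, i) (X i)
    + \sum_(i < r) \sum_(j < r | (i < j)%N) g (i, j) (X i) (X j).
  rewrite (sum_transpose (fun i j => v (j, i) (X i))) -!big_split; apply: eq_bigr => i _ /=.
  by rewrite -!big_split.
rewrite splitE !addrA; congr (_ + _).
rewrite -!big_split /=; apply: eq_bigr => i _; rewrite -/(X i) /A; ring.
Qed.

End Assembly.

(** * Quadratic polynomials *)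

Lemma subset_pair (T : finType) (x0 : T) (A : {set T}) :
  (#|A| <= 2)%N -> exists q : T * T, A \subset [set q.1; q.2].
Proof.
move=> A2; have [->|[i iA]] := set_0Vmem A; first by exists (x0, x0); rewrite sub0set.
have [A0|[j jA]] := set_0Vmem (A :\ i).
  by exists (i, i); rewrite -(setD1K iA) A0 setU0 /= setUid.
exists (i, j); rewrite /= -(setD1K iA) setUS //.
have : (#|A :\ i| <= 1)%N by move: A2; rewrite (cardsD1 i) iA.
move=> A1; apply/subsetP => k kA; rewrite inE; apply/eqP.
by move/card_le1_eqP: A1; apply.
Qed.

(** [msize f <= 3] means degree at most 2, so a monomial involves at most two coordinates and hence
    at most two of the [r] points. Each monomial is assigned to one such pair. *)
Lemma eval_at_pair_sum (R : realType) (r d N : nat) (p : 'I_N -> 'rV[R]_d)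
    (f : {mpoly R[r * d]}) : (0 < r)%N -> (msize f <= 3)%N ->
  exists h : 'I_r -> 'I_r -> 'I_N -> 'I_N -> R, forall x,
    eval_at p f x = \sum_i \sum_j h i j (x i) (x j).
Proof.
move=> r0 fdeg; pose v (x : 'I_r -> 'I_N) (k : 'I_(r * d)) : R := mxvec (tuple_mx p x) 0 k.
have [row rowP] : exists row : 'I_(r * d) -> 'I_r,
    forall k x y, x (row k) = y (row k) -> v x k = v y k.
  apply: (@fin_all_exists _ (fun=> 'I_r)
    (fun k i => forall x y, x i = y i -> v x k = v y k)) => k.
  case/mxvec_indexP: k => i j; exists i => x y xy.
  by rewrite /v !mxvecE !mxE xy.
pose covers (m : 'X_{1..r * d}) (q : 'I_r * 'I_r) :=
  [forall k, (m k != 0%N) ==> ((row k == q.1) || (row k == q.2))].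
pose pr m := odflt (Ordinal r0, Ordinal r0) [pick q | covers m q].
have prP m : m \in msupp f -> covers m (pr m).
  move=> mf; rewrite /pr; case: pickP => //= none.
  have [q qP] : exists q : 'I_r * 'I_r,
      [set row k | k in [set k | m k != 0%N]] \subset [set q.1; q.2].
    apply: (subset_pair (Ordinal r0)); apply: leq_trans (leq_imset_card _ _) _.
    have := msize_mdeg_lt mf; move/leq_trans => /(_ _ fdeg); rewrite ltnS; apply: leq_trans.
    rewrite mdegE -sum1_card big_mkcond /=; apply: leq_sum => k _.
    by rewrite inE; case: ifP => //; rewrite lt0n.
  have := none q; rewrite /covers => /negbT/negP[]; apply/forallP => k; apply/implyP => mk.
  by have := subsetP qP (row k); rewrite !inE; apply; apply: imset_f; rewrite inE.
pose mono x (m : 'X_{1..r * d}) := f@_m * \prod_k v x k ^+ m k.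
(* Point [i] is set to [y] and all others to [z]; the monomials assigned to [(i, j)] see only the
   points [i] and [j]. *)
exists (fun i j y z => \sum_(m <- msupp f | pr m == (i, j))
  mono (fun t => if t == i then y else z) m) => x.
rewrite /eval_at mevalE pair_bigA /= (exchange_big_dep xpredT) //=.
rewrite [LHS]big_seq [RHS]big_seq; apply: eq_bigr => m mf.
rewrite (big_pred1 (pr m)); last by move=> q /=; rewrite eq_sym -surjective_pairing.
congr (_ * _); apply: eq_bigr => k _.
have [->|mk] := eqVneq (m k) 0%N; first by rewrite !expr0.
congr (_ ^+ _); apply: rowP.
have /forallP/(_ k) := prP m mf; rewrite mk /=.
by case: eqP => [->//|_] /= /eqP->.
Qed.

Theorem theorem4p3 (R : realType) (r d : nat) :
  (0 < r)%N -> (0 < d)%N ->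
  exists C : R, 0 < C /\
    forall n : nat, (0 < n)%N ->
    forall (N : nat) (p : 'I_N -> 'rV[R]_d) (f : {mpoly R[r * d]})
           (Gamma : bool -> bool),
      injective p ->
      (msize f <= 3)%N ->
      tw 12 (C * n%:R) <= N%:R ->
      exists S : {set 'I_N}, #|S| = n /\
        (sa_clique p f Gamma S \/ sa_independent p f Gamma S).
Proof.
move=> r0 _; have [c c0 hc] := points_needed_bounded r.
exists c%:R; split; first by rewrite ltr0n.
move=> n n0 N p f Gamma _ fdeg; rewrite -natrM tw_nat ler_nat => leN.
have {}leN : (points_needed r n <= N)%N.
  (* [tw 12] is eleven exponentials, as [tw 1] is the identity; [leq_towerS] passes from ten to
     eleven. *)
  exact: leq_trans (leq_trans (hc n n0) (leq_towerS _ _)) leN.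
have [h hE] := eval_at_pair_sum p r0 fdeg.
have N0 : (0 < N)%N.
  (* The zero functions serve only to show that ['I_N] is inhabited, which gives the default value
     in [o]. *)
  have [b [[_ bN] _]] := @pair_sum_ramsey R r n N (fun _ _ _ _ => 0) leN.
  exact: leq_ltn_trans (leq0n _) (bN 0%N n0).
pose o k : 'I_N := insubd (Ordinal N0) k.
have [b [[b1 b2] [v hv]]] :=
  @pair_sum_ramsey R r n N (fun i j y z => h i j (o y) (o z)) leN.
have oE k : (k < n)%N -> nat_of_ord (o (b k)) = b k.
  by move=> kn; rewrite /o val_insubd b2.
have b_lt k l : (k < n)%N -> (l < n)%N -> (b k < b l)%N -> (k < l)%N.
  move=> kn ln; rewrite !ltnNge; apply: contra; rewrite leq_eqVlt => /orP[/eqP->//|lk].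
  by rewrite ltnW // b1 // lk.
exists [set o (b (k : 'I_n)) | k in 'I_n]; split.
  rewrite card_imset ?card_ord // => k l /(congr1 (@nat_of_ord N)).
  rewrite !oE // => bkl; apply: ord_inj; case: (ltngtP k l) => // lt.
    by have := b1 k l; rewrite lt ltn_ord bkl ltnn => /(_ isT).
  by have := b1 l k; rewrite lt ltn_ord bkl ltnn => /(_ isT).
have edgeE x : increasing x -> (forall i, x i \in [set o (b (k : 'I_n)) | k in 'I_n]) ->
    sa_edge p f Gamma x = Gamma v.
  move=> xi xS; have [t ht] : exists t : 'I_r -> 'I_n, forall i, x i = o (b (t i)).
    apply: (@fin_all_exists _ (fun=> 'I_n) (fun i k => x i = o (b k))) => i.
    by have /imsetP[k _ ->] := xS i; exists k.
  rewrite /sa_edge hE -(hv (fun i => t i)); last first.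
    split=> [i j ij|i]; last exact: ltn_ord.
    by apply: b_lt => //; have := xi i j ij; rewrite !ht !oE.
  by congr (Gamma (_ <= 0)); apply: eq_bigr => i _; apply: eq_bigr => j _; rewrite !ht.
case E : (Gamma v); [left|right] => x xi xS; by rewrite edgeE // E.
Qed.
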